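(* Let $k$ be a field, let $1\leq s\leq n$ be integers, and put $\ell=s-1$ and $r=n-s$. Let $Q$ be the quiver with vertices $1,\dots,n$ whose underlying graph is the path $1-2-\cdots-n$, oriented with a unique source at $s$, i.e. with arrows $i\to i-1$ for $2\leq i\leq s$ and $i\to i+1$ for $s\leq i\leq n-1$. Then the set $$\mathcal{F}=\big\{[a,b]\colon 1\leq a\leq s\leq b\leq n\big\}$$ is a maximum antichain of size $(\ell+1)(r+1)$ in the poset $(\mathcal{P}_Q,\leq)$.
   Context: A representation $V$ of a quiver $Q$ over $k$ assigns a finite-dimensional $k$-vector space $V_i$ to every vertex $i$ and a $k$-linear map $V_\alpha\colon V_i\to V_j$ to every arrow $\alpha\colon i\to j$. A morphism $\phi\colon V\to W$ is a family of linear maps $\phi_i\colon V_i\to W_i$ with $W_\alpha\circ\phi_i=\phi_j\circ V_\alpha$ for every arrow $\alpha\colon i\to j$; it is a monomorphism if every $\phi_i$ is injective. For a quiver $Q$ whose underlying graph is the path $1-2-\cdots-n$ and for $1\leq a\leq b\leq n$, let $[a,b]$ denote the representation with $V_i=k$ for $a\leq i\leq b$ and $V_i=0$ otherwise, with $V_\alpha=\mathrm{id}_k$ for every arrow $\alpha$ between vertices in $\{a,\dots,b\}$ and $V_\alpha=0$ for all other arrows. (These represent all isomorphism classes of indecomposable representations of $Q$.) Let $\mathcal{P}_Q=\{[a,b]\colon 1\leq a\leq b\leq n\}$, ordered by $[a,b]\leq[a',b']$ if and only if there exists a monomorphism $[a,b]\hookrightarrow[a',b']$. An antichain in a poset is a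 subset of pairwise incomparable elements; it is maximum if no antichain has larger cardinality. *)

(* Defs.v *)
From HB Require Import structures.
From mathcomp Require Import all_boot all_order all_algebra.
From mathcomp Require Import boolp.

Set Implicit Arguments.
Unset Strict Implicit.
Unset Printing Implicit Defensive.

Import Order.TTheory GRing.Theory.

Local Open Scope nat_scope.

Record quiver (I : finType) := Quiver {
  arrow : finType;
  src : arrow -> I;
  tgt : arrow -> I
}.

Record representation (k : fieldType) (I : finType) (Q : quiver I) :=
  Representation {
    rep_space : I -> vectType k;
    rep_map : forall al : arrow Q,
      'Hom(rep_space (src al), rep_space (tgt al))
  }.

Record rep_morphism (k : fieldType) (I : finType) (Q : quiver I)
    (V W : representation k Q) := RepMorphism {
  mor_map : forall i : I, 'Hom(rep_space V i, rep_space W i);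
  mor_comm : forall al : arrow Q,
    (rep_map W al \o mor_map (src al) = mor_map (tgt al) \o rep_map V al)%VF
}.

Definition monomorphism (k : fieldType) (I : finType) (Q : quiver I)
    (V W : representation k Q) (phi : rep_morphism V W) : Prop :=
  forall i : I, injective (mor_map phi i).

(* 'I_n.+1 without 0, so that vertices keep the labels 1, ..., n. *)
Definition vertex (n : nat) : finType := {i : 'I_n.+1 | 1 <= i}.

Definition label (n : nat) (i : vertex n) : nat := val (val i).

Definition interval (n : nat) : finType :=
  {ab : 'I_n.+1 * 'I_n.+1 | 1 <= ab.1 <= ab.2}.

Definition left_end (n : nat) (x : interval n) : nat := (val x).1.

Definition right_end (n : nat) (x : interval n) : nat := (val x).2.

Definition in_interval (n : nat) (x : interval n) (i : vertex n) : bool :=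
  left_end x <= label i <= right_end x.

Definition unit_space (k : fieldType) (b : bool) : vectType k :=
  if b then (k^o : vectType k) else ('rV[k]_0 : vectType k).

Definition unit_map (k : fieldType) (b c : bool) :
    'Hom(unit_space k b, unit_space k c) :=
  match b, c return 'Hom(unit_space k b, unit_space k c) with
  | true, true => \1%VF
  | _, _ => 0%R
  end.

(* The representation [a,b]; it is only meant for quivers Q on the vertices   *)
(* 1, ..., n whose underlying graph is the path 1 - 2 - ... - n, although the *)
(* formula makes sense for any Q.                                             *)
Definition interval_rep (k : fieldType) (n : nat) (Q : quiver (vertex n))
    (x : interval n) : representation k Q :=
  @Representation k (vertex n) Q
    (fun i => unit_space k (in_interval x i))
    (fun al => unit_map k (in_interval x (src al)) (in_interval x (tgt al))).

Section MonomorphismOrder.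

Variables (k : fieldType) (I : finType) (Q : quiver I).
Implicit Types V W X : representation k Q.

Definition embeds V W : Prop :=
  exists phi : rep_morphism V W, monomorphism phi.

Lemma embeds_refl V : embeds V V.
Proof.
have H (al : arrow Q) :
    (rep_map V al \o \1 = \1 \o rep_map V al)%VF.
  by rewrite comp_lfun1l comp_lfun1r.
exists (@RepMorphism k I Q V V (fun i => \1%VF) H) => i u v /=.
by rewrite !id_lfunE.
Qed.

Lemma embeds_trans W V X : embeds V W -> embeds W X -> embeds V X.
Proof.
move=> [f injf] [g injg].
have H (al : arrow Q) :
    (rep_map X al \o (mor_map g (src al) \o mor_map f (src al))
     = (mor_map g (tgt al) \o mor_map f (tgt al)) \o rep_map V al)%VF.
  by rewrite comp_lfunA mor_comm -comp_lfunA mor_comm comp_lfunA.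
exists (@RepMorphism k I Q V X
  (fun i => (mor_map g i \o mor_map f i)%VF) H) => i u v /=.
by rewrite !comp_lfunE => /injg /injf.
Qed.

End MonomorphismOrder.

Lemma embeds_in_interval (k : fieldType) (n : nat) (Q : quiver (vertex n))
    (x y : interval n) (i : vertex n) :
  embeds (interval_rep k Q x) (interval_rep k Q y) ->
  in_interval x i -> in_interval y i.
Proof.
move=> [phi /(_ i)]; move: (mor_map phi i) => /=.
case: (in_interval x i) => //; case: (in_interval y i) => //= f injf _.
have : (1%R : k^o) = 0%R :> k^o.
  by apply: injf; rewrite [LHS]thinmx0 [RHS]thinmx0.
by move/eqP; rewrite oner_eq0.
Qed.

(* The elements [a,b] of P_Q, represented by the pairs (a, b): distinct pairs *)
(* have distinct, even non-isomorphic, representations (see [embeds_anti]).   *)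
Definition interval_poset (k : fieldType) (n : nat) (Q : quiver (vertex n)) :
  Type := interval n.

HB.instance Definition _ (k : fieldType) (n : nat) (Q : quiver (vertex n)) :=
  Finite.copy (interval_poset k Q) (interval n).

Section IntervalPoset.

Variables (k : fieldType) (n : nat) (Q : quiver (vertex n)).

Definition interval_le (x y : interval_poset k Q) : bool :=
  `[< embeds (interval_rep k Q x) (interval_rep k Q y) >].

Lemma interval_le_refl : reflexive interval_le.
Proof. by move=> x; apply/asboolP; apply: embeds_refl. Qed.

Lemma interval_le_trans : transitive interval_le.
Proof.
move=> y x z /asboolP xy /asboolP yz; apply/asboolP.
exact: embeds_trans xy yz.
Qed.

Lemma embeds_ends (x y : interval n) :
  embeds (interval_rep k Q x) (interval_rep k Q y) ->
  (left_end y <= left_end x) && (right_end x <= right_end y).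
Proof.
case: x => -[a b] /= ab; have /andP[a1 leab] := ab.
have b1 : 1 <= b := leq_trans a1 leab.
move=> xy.
have /= := embeds_in_interval (i := exist _ a a1 : vertex n) xy.
have /= := embeds_in_interval (i := exist _ b b1 : vertex n) xy.
rewrite /in_interval /left_end /right_end /label /= !leqnn leab /=.
by move=> /(_ isT) /andP[_ ->] /(_ isT) /andP[-> _].
Qed.

Lemma embeds_anti (x y : interval n) :
  embeds (interval_rep k Q x) (interval_rep k Q y) ->
  embeds (interval_rep k Q y) (interval_rep k Q x) -> x = y.
Proof.
move=> /embeds_ends /andP[l1 r1] /embeds_ends /andP[l2 r2].
apply: val_inj; apply/eqP; rewrite -pair_eqE /=.
by apply/andP; split; apply/eqP/val_inj/eqP; rewrite eqn_leq; apply/andP.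
Qed.

Lemma interval_le_anti : antisymmetric interval_le.
Proof. by move=> x y /andP[/asboolP xy /asboolP yx]; apply: embeds_anti. Qed.

End IntervalPoset.

Fact interval_display : Order.disp_t. Proof. exact: Order.Disp tt tt. Qed.

HB.instance Definition _ (k : fieldType) (n : nat) (Q : quiver (vertex n)) :=
  Order.Le_isPOrder.Build interval_display (interval_poset k Q)
    (@interval_le_refl k n Q) (@interval_le_anti k n Q)
    (@interval_le_trans k n Q).

Definition antichain (d : Order.disp_t) (P : finPOrderType d) (A : {set P}) :
  Prop := {in A &, forall x y : P, x != y -> (x >< y)%O}.

Definition maximum_antichain (d : Order.disp_t) (P : finPOrderType d)
    (A : {set P}) : Prop :=
  antichain A /\ forall B : {set P}, antichain B -> #|B| <= #|A|.

(* An arrow is the pair (source, target). *)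
Definition source_quiver (n s : nat) : quiver (vertex n) :=
  @Quiver (vertex n)
    {e : vertex n * vertex n |
      ((2 <= label e.1 <= s) && (label e.2 == (label e.1).-1))
      || ((s <= label e.1 <= n.-1) && (label e.2 == (label e.1).+1))}
    (fun al => (val al).1)
    (fun al => (val al).2).

Definition intervals_through (k : fieldType) (n s : nat) :
    {set interval_poset k (source_quiver n s)} :=
  [set x : interval_poset k (source_quiver n s) |
    (1 <= left_end x <= s) && (s <= right_end x <= n)].

(* Main.v *)
Require Import Defs.
From HB Require Import structures.
From mathcomp Require Import all_boot all_order all_algebra.
From mathcomp Require Import boolp zify.

(** A family of injective maps between interval representations commutes with
    an arrow of [y] only if the arrow does not lead out of [x]: otherwise one
    path around the square is injective on a line and the other one is zero.
    Hence [x] embeds into [y] exactly when [x] is contained in [y] and closed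
    under the arrows of [y] ([embeds_intervalP]), a purely combinatorial
    condition.

    For the quiver with unique source [s] all arrows point away from [s].  An
    interval containing [s] and closed under the arrows of a larger interval
    must be that whole interval, so the intervals through [s] are maximal
    elements of the poset ([through_source_maximal]); in particular they form an
    antichain.

    For the upper bound, the poset is partitioned into as many chains as there
    are intervals through [s].  The partition is given by the fibres of the map
    sending [[a,b]] to its hull with [s], [[min a s, max b s]].  An interval
    [[a,b]] on the left of [s] is closed under the arrows of every [[a,b']] with
    [b <= b'], so [[a,a] < [a,a+1] < ... < [a,s]] is a chain, and it is
    the fibre of [[a,s]] when [a < s].  Symmetrically, the fibre of [[s,b]] is a
    chain when [s < b], and all other fibres are singletons.  Hence the hull is
    injective on any antichain ([hull_inj_antichain]), which therefore has at
    most as many elements as there are intervals through [s]. *)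

Set Implicit Arguments.
Unset Strict Implicit.
Unset Printing Implicit Defensive.

Local Open Scope nat_scope.

(** * Embeddings between interval representations *)

Section Embeddings.

Variables (k : fieldType) (n : nat).

Lemma interval_eq (x y : Defs.interval n) :
  left_end x = left_end y -> right_end x = right_end y -> x = y.
Proof.
move=> /val_inj el /val_inj er; apply: val_inj.
by rewrite [LHS]surjective_pairing el er -surjective_pairing.
Qed.

Lemma interval_bounds (x : Defs.interval n) :
  1 <= left_end x <= right_end x /\ right_end x <= n.
Proof. by split; [exact: (valP x) | rewrite -ltnS; exact: ltn_ord]. Qed.

Lemma interval_ex a b :
  1 <= a <= b -> b <= n -> {x : Defs.interval n | left_end x = a & right_end x = b}.
Proof.
move=> /[dup] ab /andP[_ leab] lebn.
pose p : 'I_n.+1 * 'I_n.+1 := (inord a, inord b).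
have Hp : 1 <= p.1 <= p.2 by rewrite /= !inordK // ltnS (leq_trans leab).
by exists (exist _ p Hp : Defs.interval n);
  rewrite /left_end /right_end /= inordK // ltnS (leq_trans leab).
Qed.

Lemma vertex_ex i : 1 <= i <= n -> exists v : vertex n, label v = i.
Proof.
move=> /andP[i1 lein]; pose j : 'I_n.+1 := inord i.
have Hj : 1 <= j by rewrite inordK.
by exists (exist _ j Hj : vertex n); rewrite /label /= inordK.
Qed.

(** Here [xs], [xt], [ys], [yt] tell whether the source and the target of an arrow
    lie in [x] and in [y].  The second hypothesis excludes the one case where the
    square fails to commute: the path through [y] is the identity and the path
    through [x] is zero. *)
Lemma unit_map_square (xs xt ys yt : bool) :
  (xs -> ys) -> (xs -> yt -> xt) ->
  (unit_map k ys yt \o unit_map k xs ys = unit_map k xt yt \o unit_map k xs xt)%VF.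
Proof.
case: xs xt ys yt => [] [] [] [] //= h1 h2;
  rewrite ?comp_lfun0l ?comp_lfun0r //; first [by have := h1 isT | by have := h2 isT isT].
Qed.

Lemma unit_map_inj (b c : bool) : (b -> c) -> injective (unit_map k b c).
Proof.
case: b c => [] [] /= h; last by move=> u v _; rewrite [LHS]thinmx0 [RHS]thinmx0.
- by move=> u v; rewrite !id_lfunE.
- by have := h isT.
- by move=> u v _; rewrite [LHS]thinmx0 [RHS]thinmx0.
Qed.

Lemma embeds_intervalP (Q : quiver (vertex n)) (x y : Defs.interval n) :
  embeds (interval_rep k Q x) (interval_rep k Q y) <->
  (forall i, in_interval x i -> in_interval y i) /\
  (forall al : arrow Q, in_interval x (src al) -> in_interval y (tgt al) ->
     in_interval x (tgt al)).
Proof.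
split=> [xy | [sub_xy closed]].
  split=> [i | al xs yt]; first exact: embeds_in_interval xy.
  have ys := embeds_in_interval xy xs.
  have [phi injphi] := xy; have := mor_comm phi al; have := injphi (src al).
  move: (mor_map phi (src al)) (mor_map phi (tgt al)) => /=.
  move: xs ys yt; case: (in_interval x (src al)) => // _.
  case: (in_interval y (src al)) => // _; case: (in_interval y (tgt al)) => // _.
  case: (in_interval x (tgt al)) => //= f g injf.
  (* With the target outside [x], commutation reads [\1 \o f = g \o 0]. *)
  rewrite comp_lfun0r comp_lfun1l => f0.
  have : (1%R : k^o) = 0%R :> k^o by apply: injf; rewrite f0 !lfunE.
  by move/eqP; rewrite GRing.oner_eq0.
have comm (al : arrow Q) := unit_map_square (sub_xy (src al)) (closed al).
exists (@RepMorphism k _ Q (interval_rep k Q x) (interval_rep k Q y)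
  (fun i => unit_map k (in_interval x i) (in_interval y i)) comm) => i.
exact: unit_map_inj (sub_xy i).
Qed.

End Embeddings.

(** * The quiver with a unique source *)

Section SourceQuiver.

Variables (k : fieldType) (n s : nat).
Local Notation Q := (source_quiver n s).
Local Notation P := (interval_poset k Q).
Implicit Types x y : P.

Definition through_source (x : Defs.interval n) : bool :=
  left_end x <= s <= right_end x.

Lemma arrow_ex (u v : vertex n) :
  ((2 <= label u <= s) && (label v == (label u).-1))
    || ((s <= label u <= n.-1) && (label v == (label u).+1)) ->
  exists2 al : arrow Q, src al = u & tgt al = v.
Proof.
move=> H; pose e : vertex n * vertex n := (u, v).
by exists (exist _ e H : arrow Q).
Qed.

(** If [y] were strictly larger than [x] at one end, the arrow leaving [x] at
    that end would stay inside [y]. *)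
Lemma through_source_maximal x y : through_source x -> (x <= y)%O -> x = y.
Proof.
move=> /andP[las lsb] /asboolP xy; have /andP[le_l le_r] := embeds_ends xy.
have /embeds_intervalP[_ closed] := xy.
have [/andP[x1 x2] x3] := interval_bounds x.
have [/andP[y1 y2] y3] := interval_bounds y.
apply: interval_eq; apply/eqP; rewrite eqn_leq ?le_l ?le_r ?andbT /= leqNgt;
  apply/negP => lt.
- have [|u lu] := @vertex_ex n (left_end x); first by lia.
  have [|v lv] := @vertex_ex n (left_end x).-1; first by lia.
  have [|al su tv] := @arrow_ex u v; first by lia.
  by have := closed al; rewrite su tv /in_interval lu lv; lia.
- have [|u lu] := @vertex_ex n (right_end x); first by lia.
  have [|v lv] := @vertex_ex n (right_end x).+1; first by lia.
  have [|al su tv] := @arrow_ex u v; first by lia.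
  by have := closed al; rewrite su tv /in_interval lu lv; lia.
Qed.

(** All arrows starting left of the source point left, so they can leave [x]
    only at the left end, and that end it shares with [y]. *)
Lemma le_same_left x y :
  left_end x = left_end y -> right_end x <= right_end y -> right_end x < s ->
  (x <= y)%O.
Proof.
move=> el ler lts; apply/asboolP/embeds_intervalP; split=> [i | [[u v] /= H]];
  by rewrite /in_interval; lia.
Qed.

Lemma le_same_right x y :
  right_end x = right_end y -> left_end y <= left_end x -> s < left_end x ->
  (x <= y)%O.
Proof.
move=> er lel lts; apply/asboolP/embeds_intervalP; split=> [i | [[u v] /= H]];
  by rewrite /in_interval; lia.
Qed.

Lemma mem_intervals_through x :
  (x \in intervals_through k n s) = through_source x.
Proof.
by have := interval_bounds x; rewrite inE /through_source; lia.
Qed.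

Lemma intervals_through_antichain : antichain (intervals_through k n s).
Proof.
move=> x y; rewrite !mem_intervals_through => xs ys; apply: contra_neqT.
rewrite negbK => /orP[]; first exact: through_source_maximal.
by move/(through_source_maximal ys).
Qed.

Section Counting.

Hypothesis hs : 1 <= s <= n.

Lemma hull_ex x : {y : P | left_end y = minn (left_end x) s
                          & right_end y = maxn (right_end x) s}.
Proof. by have := interval_bounds x => hx; apply: interval_ex; lia. Qed.

Definition hull x : P := s2val (hull_ex x).

Lemma left_end_hull x : left_end (hull x) = minn (left_end x) s.
Proof. exact: (s2valP (hull_ex x)). Qed.

Lemma right_end_hull x : right_end (hull x) = maxn (right_end x) s.
Proof. exact: (s2valP' (hull_ex x)). Qed.

Lemma hull_through x : hull x \in intervals_through k n s.
Proof.
by rewrite mem_intervals_through /through_source left_end_hull right_end_hull; lia.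
Qed.

(** Two distinct intervals with the same hull share the end farther from the
    source, and the shorter one misses the source, so the shorter one embeds into
    the other. *)
Lemma hull_fibre_chain x y : hull x = hull y -> (x >=< y)%O.
Proof.
move=> e.
have := congr1 (@left_end n) e; have := congr1 (@right_end n) e.
rewrite !left_end_hull !right_end_hull => er el.
have [hx hxn] := interval_bounds x; have [hy hyn] := interval_bounds y.
rewrite /Order.comparable.
have [ltr | gtr | eqr] := ltngtP (right_end x) (right_end y).
- by rewrite le_same_left //; lia.
- by rewrite [(y <= x)%O]le_same_left ?orbT //; lia.
have [ltl | gtl | eql] := ltngtP (left_end x) (left_end y).
- by rewrite [(y <= x)%O]le_same_right ?orbT //; lia.
- by rewrite le_same_right //; lia.
by rewrite (interval_eq eql eqr) Order.POrderTheory.lexx.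
Qed.

Lemma hull_inj_antichain (B : {set P}) : antichain B -> {in B &, injective hull}.
Proof.
move=> antiB x y xB yB /hull_fibre_chain; apply: contraTeq.
exact: antiB.
Qed.

Lemma card_antichain_le (B : {set P}) :
  antichain B -> #|B| <= #|intervals_through k n s|.
Proof.
move=> /hull_inj_antichain /card_in_imset <-; apply: subset_leq_card.
by apply/subsetP => _ /imsetP[x _ ->]; exact: hull_through.
Qed.

Lemma through_ex (ij : 'I_s * 'I_(n - s).+1) :
  {x : P | left_end x = ij.1.+1 & right_end x = s + ij.2}.
Proof.
by case: ij => i j /=; have := ltn_ord i; have := ltn_ord j => ? ?;
  apply: interval_ex; lia.
Qed.

Lemma card_intervals_through : #|intervals_through k n s| = s * (n - s).+1.
Proof.
pose f ij : P := s2val (through_ex ij).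
have fl ij : left_end (f ij) = ij.1.+1 := s2valP (through_ex ij).
have fr ij : right_end (f ij) = s + ij.2 := s2valP' (through_ex ij).
have f_inj : injective f.
  move=> [i j] [i' j'] e.
  have := congr1 (@left_end n) e; have := congr1 (@right_end n) e.
  rewrite !fl !fr /= => /addnI /val_inj -> /succn_inj.
  by move=> /val_inj ->.
have -> : intervals_through k n s = f @: setT.
  apply/setP => x; rewrite mem_intervals_through; apply/idP/imsetP.
    move=> xs; have [hx hxn] := interval_bounds x; move: xs.
    rewrite /through_source => xs.
    have Hi : (left_end x).-1 < s by lia.
    have Hj : right_end x - s < (n - s).+1 by lia.
    exists (Ordinal Hi, Ordinal Hj) => //.
    by apply: interval_eq; rewrite ?fl ?fr /=; lia.
  move=> [[i j] _ ->]; rewrite /through_source fl fr /=.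
  by have := ltn_ord i; lia.
by rewrite card_imset // cardsT card_prod !card_ord.
Qed.

End Counting.

End SourceQuiver.

Theorem theorem2p6 (k : fieldType) (n s l r : nat)
    (hs : 1 <= s <= n) (hl : l = s - 1) (hr : r = n - s) :
  maximum_antichain (intervals_through k n s) /\
  #|intervals_through k n s| = (l + 1) * (r + 1).
Proof.
split; last first.
  by rewrite card_intervals_through //; congr (_ * _); lia.
split; first exact: intervals_through_antichain.
by move=> B; exact: card_antichain_le.
Qed.
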